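(* Let $G$ be a connected graph of order $n$, minimum degree $\delta \geq 3$ and maximum degree $\Delta$ that contains neither a $4$-cycle nor a $5$-cycle as a subgraph. Then \[ \operatorname{avec}(G) \leq \frac{n-\Delta^\circ}{2\delta^\circ} \cdot \frac{9n+3\Delta^\circ}{n} + 21, \] where $\delta^\circ = 2\delta^2-5\delta+5$ if $\delta$ is even, $\delta^\circ = 2\delta^2-5\delta+7$ if $\delta$ is odd, and $\Delta^\circ = \Delta(\delta-1) + (\delta-2)\sqrt{\Delta(\delta-3)} + \frac{3}{2}$.
   Context: All graphs are finite and simple. For a connected graph $G$, the eccentricity $e_G(v)$ of a vertex $v$ is $\max_{w\in V(G)} d_G(v,w)$, where $d_G$ is the shortest-path distance, and the average eccentricity is $\operatorname{avec}(G)=\frac{1}{n}\sum_{v\in V(G)} e_G(v)$ with $n=|V(G)|$. ''Containing a $k$-cycle as a subgraph'' means containing a cycle of length $k$, not necessarily induced. *)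

(* Defs.v *)
(* A finite simple graph on [T : finType] is a symmetric and
   irreflexive adjacency relation [e : rel T]. *)
From mathcomp Require Import all_boot all_order all_algebra.

Set Implicit Arguments.
Unset Strict Implicit.
Unset Printing Implicit Defensive.

Import Order.TTheory GRing.Theory Num.Theory.
Local Open Scope ring_scope.

Section Graph.

Variables (T : finType) (e : rel T).

Definition connected_graph : Prop := forall x y : T, connect e x y.

Definition degree (v : T) : nat := #|[set w | e v w]|.

(* Every degree is less than [#|T|] in a simple graph, so the default value
   [#|T|] only matters when [T] is empty (and then the result is [0]). *)
Definition min_degree : nat := (\big[minn/#|T|]_(v : T) degree v)%N.

Definition max_degree : nat := (\max_(v : T) degree v)%N.

(* [k] counts edges: the tuple [p] lists the vertices after [x]. *)
Definition has_path_of_length (k : nat) (x y : T) : bool :=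
  [exists p : k.-tuple T, [&& path e x p, last x p == y & uniq (x :: p)]].

(* A path has fewer than [#|T|] edges, so the range of [k] is exhaustive; the
   default value [#|T|] is reached only if no path joins [x] to [y]. *)
Definition dist (x y : T) : nat :=
  (\big[minn/#|T|]_(k < #|T| | has_path_of_length k x y) k)%N.

Definition eccentricity (v : T) : nat := (\max_(w : T) dist v w)%N.

(* Meant for [3 <= k]; the cycle need not be induced. *)
Definition has_cycle_of_length (k : nat) : bool :=
  [exists c : k.-tuple T, cycle e c && uniq c].

Definition avec (R : rcfType) : R :=
  #|T|%:R^-1 * \sum_(v : T) (eccentricity v)%:R.

End Graph.

Definition delta_circ (R : rcfType) (delta : nat) : R :=
  if odd delta then 2 * delta%:R ^+ 2 - 5 * delta%:R + 7
  else 2 * delta%:R ^+ 2 - 5 * delta%:R + 5.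

Definition Delta_circ (R : rcfType) (delta Delta : nat) : R :=
  Delta%:R * (delta%:R - 1)
  + (delta%:R - 2) * Num.sqrt (Delta%:R * (delta%:R - 3)) + 3 / 2.

(* Main.v *)
Require Import Defs.
From mathcomp Require Import all_boot all_order all_algebra.
From mathcomp Require Import zify lra ring.

(** Take a vertex [v] of maximum degree and a maximal family of "centres",
    consisting of [v] and of edges, such that the balls of radius 2 around the
    edges and of radius 3 around [v] are disjoint and consecutive centres are as
    close as disjointness allows.  Without 4- and 5-cycles the ball of an edge
    has at least [delta_circ] vertices and the ball of [v] at least
    [Delta_circ].  Every vertex is near a centre, so its eccentricity is at most
    6 times the eccentricity, in the graph [H] of centres, of the centre that
    owns it, plus 13.

    If [H] has [k + 1] vertices, radius [r] and diameter [D], then [D <= k],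
    [2 r <= k + 2], and every value in [(r, D]] is the eccentricity of at least
    two vertices.  Hence the deficits [D - ecc] sum to at least [(D - r) ^ 2],
    and each is weighted by a ball of at least [delta_circ] vertices.  The
    resulting bound increases with [k], and
    [k * delta_circ + Delta_circ <= n]. *)

Set Implicit Arguments.
Unset Strict Implicit.
Unset Printing Implicit Defensive.

Import Order.TTheory GRing.Theory Num.Theory.

(** * Distances and eccentricities *)

Section BigMin.

Variables (I : finType) (d : nat) (P : pred I) (F : I -> nat).

Lemma bigminn_leq i : P i -> \big[minn/d]_(j | P j) F j <= F i.
Proof.
move=> Pi; have := mem_index_enum i; elim: (index_enum I) => // j s IHs.
rewrite inE big_cons => /orP[/eqP<-|/IHs le_s]; first by rewrite Pi geq_minl.
by case: ifP => // _; rewrite geq_min le_s orbT.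
Qed.

Lemma bigminn_witness :
  \big[minn/d]_(j | P j) F j < d ->
  exists2 i, P i & \big[minn/d]_(j | P j) F j = F i.
Proof.
elim: (index_enum I) => [|j s IHs]; first by rewrite big_nil ltnn.
rewrite big_cons; case: ifP => // Pj.
by case: (leqP (F j) (\big[minn/d]_(i <- s | P i) F i)) => // _; exists j.
Qed.

End BigMin.

Section Distance.

Variables (T : finType) (e : rel T).
Hypotheses (e_sym : symmetric e) (e_conn : connected_graph e).

Lemma dist_path x p : path e x p -> dist e x (last x p) <= size p.
Proof.
case/shortenP=> p' pp' Up' sub_p.
have lt_p' : size p' < #|T|.
  by have := max_card (mem (x :: p')); rewrite (card_uniqP Up').
apply: leq_trans (uniq_leq_size _ sub_p); last by case/andP: Up'.
apply: (@bigminn_leq _ _ _ (fun k : 'I__ => k : nat) (Ordinal lt_p')).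
by apply/existsP; exists (in_tuple p'); rewrite pp' eqxx Up'.
Qed.

Lemma dist_witness x y :
  exists p, [/\ path e x p, last x p = y, uniq (x :: p) & size p = dist e x y].
Proof.
have lt_d : dist e x y < #|T|.
  case/connectP: (e_conn x y) => q /shortenP[p pp Up _] ->.
  apply: leq_ltn_trans (dist_path pp) _.
  by have := max_card (mem (x :: p)); rewrite (card_uniqP Up).
case: (bigminn_witness lt_d) => k /existsP[p /and3P[pp /eqP lp Up]] dk.
by exists p; split; rewrite // size_tuple -dk.
Qed.

Lemma dist_lt_card x y : dist e x y < #|T|.
Proof.
have [p [_ _ Up <-]] := dist_witness x y.
by have := max_card (mem (x :: p)); rewrite (card_uniqP Up).
Qed.

Lemma distxx x : dist e x x = 0.
Proof. by apply/eqP; rewrite -leqn0 (@dist_path x [::]). Qed.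

Lemma dist_edge x y : e x y -> dist e x y <= 1.
Proof. by move=> exy; apply: (@dist_path x [:: y]); rewrite /= exy. Qed.

Lemma dist_triangle y x z : dist e x z <= dist e x y + dist e y z.
Proof.
have [p [pp lp _ <-]] := dist_witness x y.
have [q [qq <- _ <-]] := dist_witness y z.
by rewrite -size_cat -lp -last_cat dist_path // cat_path pp lp.
Qed.

Lemma dist_leC x y : dist e x y <= dist e y x.
Proof.
have [p [pp <- _ <-]] := dist_witness y x.
have := @dist_path (last y p) (rev (belast y p)).
rewrite rev_path size_rev size_belast (eq_path (e' := e)) => [/(_ pp)|u v].
  by case: p {pp} => //= z p; rewrite rev_cons last_rcons.
by rewrite /= e_sym.
Qed.

Lemma distC x y : dist e x y = dist e y x.
Proof. by apply/eqP; rewrite eqn_leq !dist_leC. Qed.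

Lemma dist_eq0 x y : (dist e x y == 0) = (x == y).
Proof.
apply/idP/eqP => [/eqP d0|->]; last by rewrite distxx.
have [p [_ lp _]] := dist_witness x y.
by rewrite d0 -lp => /size0nil->.
Qed.

Lemma dist_pred x y d :
  dist e x y = d.+1 -> exists2 z, e x z & dist e z y = d.
Proof.
move=> dxy; have [[|z p] [/= pp lp _ sp]] := dist_witness x y.
  by rewrite dxy in sp.
case/andP: pp => exz pp; exists z => //; apply/eqP; rewrite eqn_leq.
have -> : dist e z y <= d.
  by rewrite -lp -ltnS -dxy -sp ltnS dist_path.
rewrite -ltnS -dxy.
by apply: leq_trans (dist_triangle z _ _) _; rewrite -add1n leq_add2r dist_edge.
Qed.

Lemma dist_ecc x y : dist e x y <= eccentricity e x.
Proof. exact: leq_bigmax. Qed.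

Lemma ecc_leq x k : (forall y, dist e x y <= k) -> eccentricity e x <= k.
Proof. by move=> le_k; apply/bigmax_leqP => y _. Qed.

Lemma ecc_witness x : exists y, dist e x y = eccentricity e x.
Proof.
have T_gt0 : 0 < #|T| by apply/card_gt0P; exists x.
by have [y dy] := bigop.eq_bigmax (dist e x) T_gt0; exists y; rewrite /eccentricity dy.
Qed.

Lemma ecc_edge x y : e x y -> eccentricity e x <= (eccentricity e y).+1.
Proof.
move=> exy; apply: ecc_leq => z; apply: leq_trans (dist_triangle y _ _) _.
by rewrite -add1n leq_add ?dist_edge ?dist_ecc.
Qed.

(** A discrete intermediate value argument: along a shortest path from [x] to [c] the eccentricity
    drops by at most 1 per edge. The distance inequality records that [y] lies on such a path. *)
Lemma ecc_intermediate t x c : eccentricity e c <= t <= eccentricity e x ->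
  exists2 y, eccentricity e y = t & dist e x y + dist e y c <= dist e x c.
Proof.
move=> /andP[le_ct]; move dxc: (dist e x c) => d.
elim: d x dxc => [|d IHd] x dxc le_tx.
  move/eqP: dxc; rewrite dist_eq0 => /eqP def_x; exists c.
    by apply/eqP; rewrite eqn_leq le_ct -def_x.
  by rewrite def_x distxx.
have [eq_tx|lt_tx] := eqVneq (eccentricity e x) t.
  by exists x; rewrite // distxx dxc.
have [z exz dzc] := dist_pred dxc.
have le_tz : t <= eccentricity e z by have := ecc_edge exz; lia.
have [y ey dy] := IHd z dzc le_tz; exists y => //.
have := dist_triangle z x y; have := dist_edge exz; lia.
Qed.

(** * Level sets of the eccentricity, and the radius *)

Section LevelSets.

Variable c : T.
Let r := eccentricity e c.

(** One vertex [y] of eccentricity [t] lies on a shortest path from [x] to [c]. With [u] farthest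
    from [y], a second one lies on a shortest path from [u] to [c]. That path misses [y], because
    its length is at most [r < t], while [u] is at distance [t] from [y]. *)
Lemma ecc_level_gt1 t x : r < t <= eccentricity e x ->
  1 < #|[set y | eccentricity e y == t]|.
Proof.
case/andP=> lt_rt le_tx.
have [|y ey _] := @ecc_intermediate t x c; first by rewrite le_tx ltnW.
have [u duy] := ecc_witness y.
have le_tu : t <= eccentricity e u by rewrite -ey -duy distC dist_ecc.
have [|z ez dz] := @ecc_intermediate t u c; first by rewrite le_tu ltnW.
have neq_yz : y != z.
  apply: contraTneq dz => <-; rewrite -ltnNge.
  have := dist_ecc c u; rewrite (distC u y) (distC u c) duy ey -/r; lia.
rewrite -(_ : #|[set y; z]| = 2); last by rewrite cards2 neq_yz.
by apply/subset_leq_card/subsetP => w /set2P[]->; rewrite inE ?ey ?ez.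
Qed.

Lemma card_ecc_le t x : r <= t <= eccentricity e x ->
  2 * (t - r) < #|[set y | eccentricity e y <= t]|.
Proof.
case/andP=> /subnK <-; elim: (t - r) => [|j IHj] le_jx.
  by rewrite addnK; apply/card_gt0P; exists c; rewrite inE.
have {IHj} := IHj (ltnW le_jx); rewrite !addnK => IHj.
have -> : [set y | eccentricity e y <= j.+1 + r] =
    [set y | eccentricity e y <= j + r] :|: [set y | eccentricity e y == j.+1 + r].
  by apply/setP=> y; rewrite !inE; lia.
rewrite cardsU (_ : _ :&: _ = set0); last by apply/setP=> y; rewrite !inE; lia.
have := @ecc_level_gt1 (j.+1 + r) x; rewrite le_jx cards0; lia.
Qed.

(** Summed by layers, the deficits count the vertices of eccentricity at most [t], for each [t]
    below the maximum. By [card_ecc_le] these counts are at least 1, 3, 5, ... from [t = r] on, and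
    consecutive odd numbers add up to a square. *)
Lemma sum_ecc_deficit x : (forall y, eccentricity e y <= eccentricity e x) ->
  (eccentricity e x - r) ^ 2 <= \sum_y (eccentricity e x - eccentricity e y).
Proof.
move=> le_D; pose level t := #|[set y | eccentricity e y <= t]|.
have layer k N : N - k = \sum_(t < N) (k <= t).
  elim: N => [|N IHN]; first by rewrite big_ord0.
  by rewrite big_ord_recr -IHN /=; lia.
have -> : \sum_y (eccentricity e x - eccentricity e y) =
    \sum_(t < eccentricity e x) level t.
  under eq_bigr do rewrite layer.
  rewrite exchange_big; apply: eq_bigr => t _.
  by rewrite /level -sum1dep_card [RHS]big_mkcond; apply: eq_bigr => y _; case: ifP.
suff sum_level N : N <= eccentricity e x -> (N - r) ^ 2 <= \sum_(t < N) level t.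
  exact: sum_level.
elim: N => [|N IHN] lt_ND; first by rewrite sub0n.
rewrite big_ord_recr /=; have {IHN} := IHN (ltnW lt_ND).
have [lt_Nr|le_rN] := ltnP N r; first by rewrite (_ : N.+1 - r = 0) //; lia.
have := @card_ecc_le N x; rewrite le_rN ltnW // -/(level N) => /(_ isT).
by rewrite subSn // -[(N - r).+1]addn1 sqrnD muln1 -addnA add1n => lt_level le_sum; apply: leq_add.
Qed.

(** Every distance layer around [c] strictly between 0 and [r] has at least two vertices. Together
    with [c] this gives [2 * (r - 1) + 1 <= #|T|]. *)
Lemma centre_bound :
  (forall x, eccentricity e c <= eccentricity e x) -> 2 * r <= #|T|.+1.
Proof.
move=> c_centre.
have [y dcy] := ecc_witness c; rewrite -/r in dcy.
pose layer i := [set z | dist e c z == i].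
have layer_gt0 i : i <= r -> exists z, dist e c z = i /\ dist e z y = r - i.
  elim: i => [|i IHi] le_ir; first by exists c; rewrite distxx subn0.
  have [z [dz dzy]] := IHi (ltnW le_ir).
  have [|w ezw dwy] := @dist_pred z y (r - i.+1); first by rewrite dzy; lia.
  exists w; split=> //; have := dist_triangle z c w; have := dist_edge ezw.
  have := dist_triangle w c y; lia.
have layer_gt1 i : 0 < i < r -> 1 < #|layer i|.
  case/andP=> i_gt0 lt_ir; rewrite ltnNge; apply/negP => le1.
  have [x [dcx _]] := layer_gt0 i (ltnW lt_ir).
  (* If [x] is alone in its layer, stepping from [c] towards [x] would lower
     the eccentricity. *)
  have uniq_x z : dist e c z = i -> z = x.
    by move=> dz; apply/(card_le1_eqP le1); rewrite inE ?dz ?dcx.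
  (* A shortest path from [c] to [z] crosses layer [i], hence passes through [x]. *)
  have below d z : dist e c z = i + d -> dist e x z <= d.
    elim: d z => [|d IHd] z dz; first by rewrite (uniq_x z) ?distxx // dz addn0.
    have [|w ezw dwc] := @dist_pred z c (i + d); first by rewrite distC; lia.
    have := IHd w; rewrite distC => /(_ dwc); have := dist_triangle w x z.
    by have := dist_edge ezw; rewrite (distC z w); lia.
  have [|c' ecc' dc'x] := @dist_pred c x i.-1; first by lia.
  (* Vertices in layer [i] or beyond are reached from [c'] through [x], which saves one step. The
     others are within [i <= r - 1] of [c']. *)
  have : eccentricity e c' <= r.-1.
    apply: ecc_leq => z; have le_r := dist_ecc c z; rewrite -/r in le_r.
    have [le_i|lt_i] := leqP i (dist e c z).
      have := below (dist e c z - i) z; have := dist_triangle x c' z.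
      by rewrite subnKC // => ? /(_ erefl); lia.
    have := dist_triangle c c' z; have := dist_edge ecc'; rewrite (distC c c').
    lia.
  have := c_centre c'; rewrite -/r; lia.
have {}layer_gt0 i : i <= r -> 0 < #|layer i|.
  by case/layer_gt0=> z [dz _]; apply/card_gt0P; exists z; rewrite inE dz.
have sum_layer N : N < r -> 2 * N < #|[set z | dist e c z <= N]|.
  elim: N => [|N IHN] lt_Nr; first by apply/card_gt0P; exists c; rewrite inE distxx.
  have {IHN} := IHN (ltnW lt_Nr); have := layer_gt1 N.+1 lt_Nr.
  have -> : [set z | dist e c z <= N.+1] = [set z | dist e c z <= N] :|: layer N.+1.
    by apply/setP=> z; rewrite !inE; lia.
  rewrite cardsU (_ : _ :&: _ = set0); last by apply/setP=> z; rewrite !inE; lia.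
  by rewrite cards0; lia.
case: (posnP r) => [->//|r_gt0].
have := leq_trans (sum_layer r.-1 _) (max_card _); rewrite ltn_predL => /(_ r_gt0).
by case: (r) r_gt0 => // r' _; rewrite mulnS.
Qed.

End LevelSets.

End Distance.

(** * Centres *)

Lemma connect_step (T : finType) (e : rel T) (P : pred T) x y :
  connect e x y -> P x -> ~~ P y -> exists a b, [/\ e a b, P a & ~~ P b].
Proof.
case/connectP=> p pp ->; elim: p x pp => [|z p IHp] x /=; first by move=> _ ->.
case/andP=> exz pp Px nPy; have [Pz|nPz] := boolP (P z); first exact: (IHp z).
by exists x, z.
Qed.

Section Centres.

Variables (T : finType) (e : rel T) (v : T).
Hypotheses (e_sym : symmetric e) (e_irr : irreflexive e).
Hypothesis e_conn : connected_graph e.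

(* A centre is an edge, or the pair [(v, v)] whose ball has radius 3
   instead of 2. *)
Definition centre (p : T * T) := (p == (v, v)) || e p.1 p.2.

(** Lowering the distance from [v] by 1 lets the same threshold describe the ball of radius 3 around
    [v] and the balls of radius 2 around edges. *)
Definition centre_dist (p : T * T) (w : T) : nat :=
  if p == (v, v) then (dist e v w).-1 else minn (dist e p.1 w) (dist e p.2 w).

Definition centre_ball (p : T * T) : {set T} := [set w | centre_dist p w <= 2].

(* Linked centres are at distance at most 5 (6 for [(v, v)]); one more step
   crosses the edge [p], and leaving [(v, v)] pays back the unit that
   [centre_dist] discounts there. *)
Definition centre_link : rel (T * T) := fun p q =>
  [forall w, centre_dist q w <= centre_dist p w + 6 + (p == (v, v))].

Definition centre_near : rel (T * T) :=
  fun p q => centre_link p q && centre_link q p.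

Lemma centre_dist_lip p x z :
  centre_dist p x <= centre_dist p z + dist e z x.
Proof.
rewrite /centre_dist; case: ifP => _.
  have := dist_triangle e_conn z v x; lia.
have := dist_triangle e_conn z p.1 x; have := dist_triangle e_conn z p.2 x; lia.
Qed.

(** A walk through [p] may have to cross its edge, which costs 1. At [(v, v)] there is no edge to
    cross, but the discounts on both sides are paid back, which costs 2. *)
Lemma dist_centre p a w : centre p ->
  dist e a w <= centre_dist p a + centre_dist p w + 1 + (p == (v, v)).
Proof.
rewrite /centre /centre_dist; case: eqVneq => [_ _|_ /= ep].
  by have := dist_triangle e_conn v a w; rewrite (distC e_sym e_conn a v); lia.
have := dist_triangle e_conn p.1 a w; have := dist_triangle e_conn p.2 a w.
have := dist_triangle e_conn p.2 p.1 w; have := dist_triangle e_conn p.1 p.2 w.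
have := dist_edge ep; rewrite (distC e_sym e_conn p.2 p.1).
rewrite (distC e_sym e_conn a p.1) (distC e_sym e_conn a p.2).
lia.
Qed.

Definition within (S : {set T * T}) : rel (T * T) :=
  fun p q => [&& p \in S, q \in S & centre_near p q].

(** Connectivity by links inside [S] is part of the invariant, so that the graph of centres will be
    connected. *)
Definition packing (S : {set T * T}) :=
  [&& (v, v) \in S, [forall p in S, centre p && connect (within S) (v, v) p]
    & [forall p in S, forall q in S,
        (p != q) ==> [disjoint centre_ball p & centre_ball q]]].

Lemma packing_centre S p : packing S -> p \in S -> centre p.
Proof. by case/and3P=> _ /forall_inP cS _ /cS/andP[]. Qed.

Lemma packing_disjoint S p q : packing S -> p \in S -> q \in S -> p != q ->
  [disjoint centre_ball p & centre_ball q].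
Proof.
by case/and3P=> _ _ /forall_inP dS Sp Sq; have /forall_inP/(_ q Sq)/implyP := dS p Sp.
Qed.

(** A point common to the new ball and that of [q] would put [a] or [b] within 2 + 2 of [q]. The
    bound 5 from [p] to [a], plus 1 for the edge, is what [centre_link] permits. *)
Lemma packing_extend S p a b : packing S -> p \in S -> e a b ->
  centre_dist p a <= 5 ->
  (forall q, q \in S -> 4 < centre_dist q a /\ 5 < centre_dist q b) ->
  packing ((a, b) |: S).
Proof.
move=> pS Sp eab pa5 far; have cp := packing_centre pS Sp.
have n_ab : (a, b) == (v, v) = false.
  by apply/eqP => -[av bv]; rewrite av bv e_irr in eab.
have dist_ab w : centre_dist (a, b) w = minn (dist e a w) (dist e b w).
  by rewrite /centre_dist n_ab.
have ab1 w : dist e a w <= (centre_dist (a, b) w).+1.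
  have := dist_triangle e_conn b a w; have := dist_edge eab.
  by rewrite dist_ab; lia.
have near_p : centre_near p (a, b).
  apply/andP; split; apply/forallP => w; rewrite ?n_ab.
    by have := dist_centre a w cp; rewrite dist_ab; lia.
  by have := centre_dist_lip p w a; have := ab1 w; lia.
have sub_S : subrel (connect (within S)) (connect (within ((a, b) |: S))).
  apply: connect_sub => q r /and3P[Sq Sr qr]; apply: connect1.
  by rewrite /within !inE Sq Sr !orbT.
have disj q : q \in S -> [disjoint centre_ball q & centre_ball (a, b)].
  move=> Sq; rewrite disjoint_subset; apply/subsetP => z.
  rewrite !inE -ltnNge dist_ab => qz; have [qa qb] := far q Sq.
  have := centre_dist_lip q a z; have := centre_dist_lip q b z.
  by rewrite (distC e_sym e_conn z a) (distC e_sym e_conn z b); lia.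
case/and3P: (pS) => Sv /forall_inP cS _; apply/and3P; split.
- by rewrite inE Sv orbT.
- apply/forall_inP => q /setU1P[->|Sq].
    rewrite /centre eab orbT /=; have /andP[_ vp] := cS p Sp.
    apply: connect_trans (sub_S _ _ vp) (connect1 _).
    by rewrite /within !inE eqxx Sp near_p orbT.
  by have /andP[-> /sub_S] := cS q Sq.
- apply/forall_inP => q /setU1P[->|Sq]; apply/forall_inP => r /setU1P[->|Sr].
  + by rewrite eqxx.
  + by rewrite disjoint_sym disj ?implybT.
  + by rewrite disj ?implybT.
  + by apply/implyP; apply: packing_disjoint pS Sq Sr.
Qed.

(** Take a packing maximal for inclusion. If some vertex were far from it, a path from [v] to that
    vertex would leave the close region through an edge [(a, b)], which could be added. *)
Lemma packing_exists :
  exists2 S, packing S & forall w, exists2 p, p \in S & centre_dist p w <= 5.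
Proof.
have pv : packing [set (v, v)].
  apply/and3P; split; first by rewrite inE.
    by apply/forall_inP => p /set1P->; rewrite /centre eqxx connect0.
  by apply/forall_inP => p /set1P->; apply/forall_inP => q /set1P->; rewrite eqxx.
case: (maxset_exists pv) => S /maxsetP[pS maxS] _; exists S => // w.
pose close w := [exists p in S, centre_dist p w <= 5].
suff: close w by case/exists_inP=> p Sp pw; exists p.
apply: contraT => far_w.
have Sv : (v, v) \in S by case/and3P: pS.
have close_v : close v.
  by apply/exists_inP; exists (v, v); rewrite // /centre_dist eqxx distxx.
have [a [b [eab /exists_inP[p Sp pa5] far_b]]] :=
  connect_step (e_conn v w) close_v far_w.
have far q : q \in S -> 4 < centre_dist q a /\ 5 < centre_dist q b.
  move=> Sq; have qb : 5 < centre_dist q b.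
    by rewrite ltnNge; apply: contra far_b => qb; apply/exists_inP; exists q.
  have := centre_dist_lip q b a; have := dist_edge eab; lia.
have ext := packing_extend pS Sp eab pa5 far.
(* Contradiction: as a member of [S] the pair is at centre distance 0 from [b], yet [b] is farther
   than 5 from all of [S]. *)
have Sab : (a, b) \in S by rewrite -(maxS _ ext (subsetUr _ _)) setU11.
have [_] := far _ Sab; rewrite /centre_dist /=; case: ifP => [/eqP[_ ->]|_].
  by rewrite distxx.
by rewrite distxx minn0.
Qed.

End Centres.

(** * The graph of centres *)

Section Contraction.

Variables (T : finType) (e : rel T) (v : T) (S : {set T * T}).
Hypotheses (e_sym : symmetric e) (e_irr : irreflexive e).
Hypothesis e_conn : connected_graph e.
Hypothesis S_pack : packing e v S.
Hypothesis S_dom : forall w, exists2 p, p \in S & centre_dist e v p w <= 5.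

Let K : finType := {p : T * T | p \in S}.
Let eK : rel K := fun p q => centre_near e v (val p) (val q).

Lemma contraction_sym : symmetric eK.
Proof. by move=> p q; rewrite /eK /centre_near andbC. Qed.

Lemma contraction_conn : connected_graph eK.
Proof.
have Sv : (v, v) \in S by case/and3P: S_pack.
have path_conn s (p : K) : path (within e v S) (val p) s ->
    exists2 q : K, val q = last (val p) s & connect eK p q.
  elim: s p => [|x s IHs] p /=; first by exists p.
  case/andP=> /and3P[_ Sx px] /(IHs (Sub x Sx))[q lq xq].
  by exists q => //; apply: connect_trans (connect1 _) xq; rewrite /eK SubK.
have conn_v (p : K) : connect eK (Sub (v, v) Sv) p.
  case/and3P: S_pack => _ /forall_inP/(_ _ (valP p))/andP[_ /connectP[s ss lp]] _.
  have [|q lq vq] := path_conn s (Sub (v, v) Sv); first by rewrite SubK.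
  by rewrite (_ : p = q) //; apply: val_inj; rewrite lq SubK.
move=> p q; apply: connect_trans (conn_v q).
by rewrite (sym_connect_sym contraction_sym).
Qed.

(* A shortest path visits [(v, v)] at most once, whence the [+ 1]. *)
Lemma centre_dist_path (p q : K) w :
  centre_dist e v (val q) w <= centre_dist e v (val p) w + 6 * dist eK p q + 1.
Proof.
have [s [ps <- Us <-]] := dist_witness contraction_conn p q.
suff main : centre_dist e v (val (last p s)) w
    <= centre_dist e v (val p) w + 6 * size s + count_mem (v, v) (map val (p :: s)).
  apply: leq_trans main _; rewrite leq_add2l.
  by rewrite count_uniq_mem ?leq_b1 // map_inj_uniq //; apply: val_inj.
elim: s p ps {Us} => [|x s IHs] p /=; first by lia.
case/andP=> /andP[/forallP/(_ w)/= px _] /IHs /= {IHs}; lia.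
Qed.

(** Balls take priority, so that each fibre of the owner map contains a whole ball; for the
    remaining vertices closeness is enough. *)
Definition owner_pred w (p : K) :=
  if [exists q : K, w \in centre_ball e v (val q)]
  then w \in centre_ball e v (val p) else centre_dist e v (val p) w <= 5.

Lemma owner_exists w : exists p, owner_pred w p.
Proof.
rewrite /owner_pred; have [/existsP//|_] := boolP [exists q : K, w \in centre_ball e v (val q)].
by have [p Sp pw] := S_dom w; exists (Sub p Sp); rewrite SubK.
Qed.

Let owner w := xchoose (owner_exists w).

Lemma owner_close w : centre_dist e v (val (owner w)) w <= 5.
Proof.
have := xchooseP (owner_exists w); rewrite -/(owner w) /owner_pred.
by case: ifP => // _; rewrite inE => /leq_trans->.
Qed.

Lemma owner_ball (p : K) : centre_ball e v (val p) \subset [set w | owner w == p].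
Proof.
apply/subsetP => w pw; rewrite inE; apply: contraTT isT => neq_p.
have := xchooseP (owner_exists w); rewrite -/(owner w) /owner_pred.
case: ifP => [_ ow|/existsP[]]; last by exists p.
have := packing_disjoint S_pack (valP (owner w)) (valP p).
by rewrite (inj_eq val_inj) => /(_ neq_p)/disjointFl/(_ pw); rewrite ow.
Qed.

(** The 13 is 5 + 5 from the vertices to their owners, 1 from [centre_dist_path], and at most 2 from
    [dist_centre] at the owner of [z]. *)
Lemma ecc_owner w : eccentricity e w <= 6 * eccentricity eK (owner w) + 13.
Proof.
apply: ecc_leq => z.
have oz := owner_close z; have ow := owner_close w.
have := dist_centre e_sym e_conn w z (packing_centre S_pack (valP (owner z))).
have := centre_dist_path (owner w) (owner z) w.
have := dist_ecc eK (owner w) (owner z).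
by rewrite /= in oz ow *; case: eqP => _ /=; lia.
Qed.

Lemma sum_owner (F : K -> nat) :
  \sum_w F (owner w) = \sum_p #|[set w | owner w == p]| * F p.
Proof.
rewrite (partition_big owner xpredT) //=; apply: eq_bigr => p _.
rewrite (eq_bigr (fun=> F p)) => [|w /eqP-> //].
by rewrite sum_nat_const cardsE.
Qed.

(** Here [k + 1] counts the centres, and [D] and [r] are the diameter and radius of their graph. In
    the last inequality [ecc_owner] is summed over all vertices; the deficit of each centre occurs
    once per vertex of its fibre, hence at least [s] times. *)
Lemma sum_ecc_contraction s b :
  (forall p, p \in S -> s <= #|centre_ball e v p|) ->
  b <= #|centre_ball e v (v, v)| ->
  exists k D r, [/\ s * k + b <= #|T|, D <= k, 2 * r <= k + 2
    & \sum_w eccentricity e w + 6 * (s * (D - r) ^ 2) <= (6 * D + 13) * #|T|].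
Proof.
move=> s_ball b_ball.
have Sv : (v, v) \in S by case/and3P: S_pack.
pose h : K := Sub (v, v) Sv.
pose fibre p := #|[set w | owner w == p]|.
have fibre_ball p : #|centre_ball e v (val p)| <= fibre p.
  exact: subset_leq_card (owner_ball p).
have fibre_s p : s <= fibre p by apply: leq_trans (s_ball _ (valP p)) _.
have [k def_k] : {k | #|K| = k.+1} by exists #|K|.-1; rewrite prednK //; apply/card_gt0P; exists h.
have [x _ x_max] := @arg_maxnP _ h xpredT (eccentricity eK) isT.
have [c _ c_min] := @arg_minnP _ h xpredT (eccentricity eK) isT.
have {}x_max y : eccentricity eK y <= eccentricity eK x by apply: x_max.
have {}c_min y : eccentricity eK c <= eccentricity eK y by apply: c_min.
exists k, (eccentricity eK x), (eccentricity eK c); split.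
- have -> : #|T| = \sum_p fibre p.
    rewrite -sum1_card (sum_owner (fun=> 1)).
    by apply: eq_bigr => p _; rewrite muln1.
  rewrite (bigD1 h) //= addnC leq_add //.
    by apply: leq_trans b_ball _; apply: leq_trans (fibre_ball h); rewrite SubK.
  have -> : s * k = \sum_(p | p != h) s.
    by rewrite sum_nat_const cardC1 def_k mulnC.
  exact: leq_sum.
- by apply: ecc_leq => y; rewrite -ltnS -def_k dist_lt_card //; apply: contraction_conn.
- rewrite addn2 -def_k.
  exact: (centre_bound contraction_sym contraction_conn c_min).
- set D := eccentricity eK x.
  have deficit := sum_ecc_deficit contraction_sym contraction_conn c x_max.
  apply: leq_trans (_ : \sum_w ((6 * eccentricity eK (owner w) + 13)
    + 6 * (D - eccentricity eK (owner w))) <= _).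
    rewrite big_split leq_add //=; first by apply: leq_sum => w _; apply: ecc_owner.
    rewrite -big_distrr leq_mul2l /= (sum_owner (fun p => D - eccentricity eK p)).
    apply: leq_trans (_ : \sum_p s * (D - eccentricity eK p) <= _).
      by rewrite -big_distrr leq_mul2l deficit orbT.
    by apply: leq_sum => p _; rewrite leq_mul2r fibre_s orbT.
  rewrite (eq_bigr (fun=> 6 * D + 13)) => [|w _].
    by rewrite sum_nat_const mulnC.
  by have := x_max (owner w); rewrite -/D; lia.
Qed.

End Contraction.

(** * Graphs without 4-cycles and 5-cycles *)

(** The hypothesis makes the sets counted on the left disjoint. *)
Lemma sum_card_rel_leq (I J : finType) (r : I -> J -> bool)
    (X : {set I}) (Y : {set J}) :
  (forall x x' y, x \in X -> x' \in X -> y \in Y -> r x y -> r x' y -> x = x') ->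
  \sum_(x in X) #|[set y in Y | r x y]| <= #|Y|.
Proof.
move=> r_inj; under eq_bigr do rewrite -sum1dep_card big_mkcondr.
rewrite exchange_big -sum1_card leq_sum //= => y Yy.
rewrite -big_mkcondr sum1dep_card; apply/card_le1_eqP => x x'.
by rewrite !inE => /andP[Xx rx] /andP[Xx' rx']; apply: r_inj Xx' Xx Yy rx' rx.
Qed.

Section LocalCounting.

Variables (T : finType) (e : rel T) (delta : nat).
Hypotheses (e_sym : symmetric e) (e_irr : irreflexive e).
Hypothesis delta_ge3 : 3 <= delta.
Hypothesis deg_ge : forall x, delta <= degree e x.
Hypotheses (noC4 : ~~ has_cycle_of_length e 4)
           (noC5 : ~~ has_cycle_of_length e 5).

Lemma edge_neq x y : e x y -> x != y.
Proof. by apply: contraTneq => ->; rewrite e_irr. Qed.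

Lemma C4_chord a b c d :
  e a b -> e b c -> e c d -> e d a -> (a == c) || (b == d).
Proof.
move=> ab bc cd da; apply: contraNT noC4; rewrite negb_or => /andP[nac nbd].
apply/existsP; exists [tuple a; b; c; d]; rewrite /= ab bc cd da /= !inE.
rewrite !negb_or nac nbd !edge_neq //.
by rewrite e_sym.
Qed.

Lemma C5_chord a b c d f : e a b -> e b c -> e c d -> e d f -> e f a ->
  [|| a == c, a == d, b == d, b == f | c == f].
Proof.
move=> ab bc cd df fa; apply: contraNT noC5; rewrite !negb_or.
case/and5P=> nac nad nbd nbf ncf.
apply/existsP; exists [tuple a; b; c; d; f]; rewrite /= ab bc cd df fa /= !inE.
rewrite !negb_or nac nad nbd nbf ncf !edge_neq //.
by rewrite e_sym.
Qed.

Let nbrs x (A : {set T}) := [set y in A | e x y].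

Let in_nbrs x A y : (y \in nbrs x A) = (y \in A) && e x y.
Proof. by rewrite inE. Qed.

(** The sum counts the arcs inside [X]. Reversal pairs them, so their number is even and cannot
    equal an odd [#|X|]. The set [ups] selects one arc of each pair. *)
Lemma card_nbrs_matching (X : {set T}) :
  (forall x, x \in X -> #|nbrs x X| <= 1) ->
  \sum_(x in X) #|nbrs x X| + odd #|X| <= #|X|.
Proof.
move=> matching; pose arcs := [set p : T * T | [&& p.1 \in X, p.2 \in X & e p.1 p.2]].
have sum_arcs : \sum_(x in X) #|nbrs x X| = #|arcs|.
  under eq_bigr do rewrite -sum1dep_card.
  rewrite pair_big_dep -sum1dep_card; apply: eq_bigl => -[x y] /=.
  by rewrite andbA.
have le_X : #|arcs| <= #|X| by rewrite -sum_arcs -sum1_card leq_sum.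
pose ups := [set p : T * T | enum_rank p.1 < enum_rank p.2].
have inj_swap : injective (fun p : T * T => (p.2, p.1)).
  by move=> [x y] [x' y'] [-> ->].
have even_arcs : odd #|arcs| = false.
  rewrite -(cardsID ups) (_ : arcs :\: ups = [set (p.2, p.1) | p in arcs :&: ups]).
    by rewrite card_imset // addnn odd_double.
  apply/setP => -[x y]; apply/idP/imsetP.
    rewrite !inE /= -leqNgt leq_eqVlt => /and4P[/orP[/eqP/val_inj/enum_rank_inj->|lt]].
      by rewrite e_irr.
    by move=> Xx Xy exy; exists (y, x); rewrite // !inE /= Xx Xy e_sym exy.
  case=> -[x' y']; rewrite !inE /= => /andP[/and3P[Xx Xy exy] lt] [-> ->].
  by rewrite Xx Xy e_sym exy -leqNgt ltnW.
rewrite sum_arcs; move: le_X; rewrite leq_eqVlt => /orP[/eqP<-|].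
  by rewrite even_arcs addn0.
by case: (odd _); lia.
Qed.

Lemma common_nbr u w x y :
  u != w -> e u x -> e w x -> e u y -> e w y -> x = y.
Proof.
move=> nuw ux wx uy wy; have := @C4_chord u x w y ux.
by rewrite e_sym wx (e_sym y) uy wy (negbTE nuw) => /(_ isT isT isT)/eqP.
Qed.

(** * The ball of radius 2 around an edge *)

Section Edge.

Variables a b : T.
Hypothesis eab : e a b.

Let L1 := [set x | [&& x != a, x != b & e a x || e b x]].
Let L2 := [set z | [&& z != a, z != b, z \notin L1 & [exists x in L1, e x z]]].
Let Xa := [set x | [&& x != a, x != b, e a x & ~~ e b x]].
Let Xb := [set x | [&& x != a, x != b, e b x & ~~ e a x]].
Let C := [set x | [&& x != a, x != b, e a x & e b x]].

Let sum_L1 (F : T -> nat) : \sum_(x in L1) F x =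
  \sum_(x in Xa) F x + \sum_(x in Xb) F x + \sum_(x in C) F x.
Proof.
rewrite [LHS]big_mkcond [X in X + _ + _]big_mkcond [X in _ + X + _]big_mkcond.
rewrite [X in _ + X]big_mkcond -!big_split; apply: eq_bigr => x _ /=; rewrite !inE.
by case: (x != a); case: (x != b); case: (e a x); case: (e b x); rewrite /= ?addn0.
Qed.

Let card_C : #|C| <= 1.
Proof.
apply/card_le1_eqP => x y; rewrite !inE => /and4P[_ _ ax bx] /and4P[_ _ ay by_].
exact: common_nbr (edge_neq eab) ay by_ ax bx.
Qed.

Let deg_a : delta <= #|Xa| + #|C| + 1.
Proof.
apply: leq_trans (deg_ge a) _; rewrite -(cards1 b).
apply: leq_trans (leq_add (leq_card_setU _ _) (leqnn _)).
apply: leq_trans (leq_card_setU _ _); apply: subset_leq_card.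
apply/subsetP => x; rewrite !inE => ax; rewrite ax eq_sym (edge_neq ax).
by case: (x == b); case: (e b x).
Qed.

Let deg_b : delta <= #|Xb| + #|C| + 1.
Proof.
apply: leq_trans (deg_ge b) _; rewrite -(cards1 a).
apply: leq_trans (leq_add (leq_card_setU _ _) (leqnn _)).
apply: leq_trans (leq_card_setU _ _); apply: subset_leq_card.
apply/subsetP => x; rewrite !inE => bx; rewrite bx (eq_sym x b) (edge_neq bx).
by case: (x == a); case: (x != b); case: (e a x) => //=; rewrite ?andbT ?orbT.
Qed.

Let cross x y : x != b -> y != a -> e a x -> e b y -> ~~ e x y.
Proof.
move=> xb ya ax by_; apply/negP => xy.
have := @C4_chord a x y b ax xy; rewrite e_sym by_ e_sym eab => /(_ isT isT).
by rewrite eq_sym (negbTE ya) (negbTE xb).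
Qed.

(** Two parents on the same side of the edge would close a 4-cycle through [a] or [b]; parents on
    different sides would close the 5-cycle [a], [x], [z], [y], [b]. *)
Let L2_parent x y z : x \in L1 -> y \in L1 -> z \in L2 -> e x z -> e y z -> x = y.
Proof.
rewrite !inE => /and3P[xa xb lx] /and3P[ya yb ly] /and4P[za zb _ _] xz yz.
have mixed x' y' : x' != b -> y' != a -> e a x' -> e b y' -> e x' z -> e y' z -> x' = y'.
  move=> x'b y'a ax' by' x'z y'z; apply/eqP.
  have := @C5_chord a x' z y' b ax' x'z.
  rewrite e_sym y'z e_sym by' e_sym eab => /(_ isT isT isT).
  by rewrite (eq_sym a z) (eq_sym a y') (negbTE za) (negbTE y'a) (negbTE x'b) (negbTE zb) !orbF.
case/orP: lx => lx; case/orP: ly => ly.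
- by apply: (@common_nbr a z); rewrite // 1?eq_sym // e_sym.
- exact: mixed.
- by apply/esym; apply: mixed.
- by apply: (@common_nbr b z); rewrite // 1?eq_sym // e_sym.
Qed.

Let degree_split x : x \in L1 ->
  delta <= e a x + e b x + #|nbrs x L1| + #|nbrs x L2|.
Proof.
move=> L1x; apply: leq_trans (deg_ge x) _.
have -> : e a x + e b x = #|nbrs x [set a]| + #|nbrs x [set b]|.
  have card_nbr1 y : #|nbrs x [set y]| = e y x.
    rewrite e_sym; have [xy|nxy] := boolP (e x y).
      by rewrite -[RHS](cards1 y) /nbrs; apply: eq_card => w; rewrite !inE; case: eqP => // ->.
    by apply: eq_card0 => w; rewrite !inE; case: eqP => // ->; apply: negbTE.
  by rewrite !card_nbr1.
have card_setU4 (A B A' B' : {set T}) :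
    #|A :|: B :|: A' :|: B'| <= #|A| + #|B| + #|A'| + #|B'|.
  do 2!(apply: leq_trans (leq_card_setU _ _) _; rewrite leq_add2r).
  exact: leq_card_setU.
apply: leq_trans (card_setU4 _ _ _ _).
apply: subset_leq_card; apply/subsetP => y; rewrite inE => xy.
rewrite !in_setU !in_nbrs xy !in_set1 !andbT.
have [//|ya] := eqVneq y a; have [//|yb] := eqVneq y b.
have [//|L1y] := boolP (y \in L1); rewrite inE ya yb L1y.
by apply/exists_inP; exists x.
Qed.

(** The sets of children in [L2] are disjoint, so their sizes add up. Inside [L1] a vertex of [Xa]
    has neighbours only in [Xa], at most one, likewise for [Xb], and a vertex of [C] has none.
    Parity in these two matchings yields the extra 2 for odd [delta]. *)
Lemma edge_neighbourhood_card (B : {set T}) :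
  (forall w, e a w || e b w -> w \in B) ->
  (forall x w, e a x || e b x -> e x w -> w \in B) ->
  2 * delta * delta + 5 + 2 * odd delta <= #|B| + 5 * delta.
Proof.
set N := #|B| => nearB farB.
have subB : [set a; b] :|: L1 :|: L2 \subset B.
  apply/subsetP => w; rewrite !in_setU !in_set1 => /orP[/orP[/orP[]/eqP->|]|].
  - by rewrite nearB // (e_sym b) eab orbT.
  - by rewrite nearB // eab.
  - by rewrite inE => /and3P[_ _]; apply: nearB.
  - rewrite inE => /and4P[_ _ _ /exists_inP[x]]; rewrite inE => /and3P[_ _].
    exact: farB.
have cardB : 2 + #|L1| + #|L2| <= N.
  apply: leq_trans (subset_leq_card subB).
  rewrite !cardsU (_ : [set a; b] :&: L1 = set0).
    rewrite (_ : _ :&: L2 = set0).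
      rewrite !cards0 !cards1 (_ : _ :&: _ = set0) ?cards0 ?subn0 //.
      apply/setP => x; rewrite in_setI !in_set1 in_set0; case: eqP => //= ->.
      exact/negbTE/edge_neq.
    apply/setP => x; rewrite in_set0; apply/negP.
    rewrite in_setI in_setU in_set2 [x \in L2]inE.
    by case/andP=> lhs /and4P[xa xb /negPf L1x _]; rewrite (negPf xa) (negPf xb) L1x in lhs.
  by apply/setP => x; rewrite !inE; case: (x == a); case: (x == b).
have L2_sum : \sum_(x in L1) #|nbrs x L2| <= #|L2|.
  by apply: sum_card_rel_leq => x y z; apply: L2_parent.
have XaP : \sum_(x in Xa) #|nbrs x Xa| + odd #|Xa| <= #|Xa|.
  apply: card_nbrs_matching => x; rewrite inE => /and4P[xa xb ax _].
  apply/card_le1_eqP => y z; rewrite !inE => /andP[/and4P[_ _ ay _] xy] /andP[/and4P[_ _ az _] xz].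
  exact: common_nbr (edge_neq ax) az xz ay xy.
have XbP : \sum_(x in Xb) #|nbrs x Xb| + odd #|Xb| <= #|Xb|.
  apply: card_nbrs_matching => x; rewrite inE => /and4P[xa xb bx _].
  apply/card_le1_eqP => y z; rewrite !inE => /andP[/and4P[_ _ by_ _] xy] /andP[/and4P[_ _ bz _] xz].
  exact: common_nbr (edge_neq bx) bz xz by_ xy.
have XaL x : x \in Xa -> delta <= 1 + #|nbrs x Xa| + #|nbrs x L2|.
  move=> Xax; have := Xax; rewrite inE => /and4P[xa xb ax nbx].
  have := @degree_split x; rewrite inE xa xb ax (negbTE nbx) => /(_ isT).
  rewrite (_ : nbrs x L1 = nbrs x Xa) //.
  apply/setP => y; rewrite !in_nbrs; have [xy|] := boolP (e x y); rewrite ?andbF //.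
  rewrite !inE !andbT; have [//|ya] := eqVneq y a; have [//|yb] := eqVneq y b.
  have [by_|] := boolP (e b y); last by rewrite orbF andbT.
  by have := cross xb ya ax by_; rewrite xy.
have XbL x : x \in Xb -> delta <= 1 + #|nbrs x Xb| + #|nbrs x L2|.
  move=> Xbx; have := Xbx; rewrite inE => /and4P[xa xb bx nax].
  have := @degree_split x; rewrite inE xa xb bx (negbTE nax) => /(_ isT).
  rewrite (_ : nbrs x L1 = nbrs x Xb) //.
  apply/setP => y; rewrite !in_nbrs; have [xy|] := boolP (e x y); rewrite ?andbF //.
  rewrite !inE !andbT; have [//|ya] := eqVneq y a; have [//|yb] := eqVneq y b.
  have [ay|] := boolP (e a y); last by rewrite andbT.
  by have := cross yb xa ay bx; rewrite e_sym xy.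
have CL x : x \in C -> delta <= 2 + #|nbrs x L2|.
  rewrite inE => /and4P[xa xb ax bx].
  have := @degree_split x; rewrite inE xa xb ax bx => /(_ isT).
  rewrite (_ : nbrs x L1 = set0) ?cards0 //.
  apply/setP => y; rewrite in_nbrs in_set0 !inE; apply/negP => /andP[/and3P[ya yb]].
  case/orP=> [ay|by_] xy; last by have := cross xb ya ax by_; rewrite xy.
  by have := cross yb xa ay bx; rewrite e_sym xy.
have := leq_sum (index_enum T) XaL; have := leq_sum (index_enum T) XbL.
have := leq_sum (index_enum T) CL.
rewrite !big_split !sum_nat_const /= !muln1 => sumC sumXb sumXa.
move: L2_sum cardB deg_a deg_b card_C; rewrite !sum_L1.
have -> : #|L1| = #|Xa| + #|Xb| + #|C| by rewrite -!sum1_card sum_L1.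
move: sumC sumXb sumXa XaP XbP; move: (\sum_(x in Xa) #|nbrs x Xa|) (\sum_(x in Xb) #|nbrs x Xb|).
move: (\sum_(x in Xa) _) (\sum_(x in Xb) _) (\sum_(x in C) _).
move: #|Xa| #|Xb| #|C| #|L2| => ta tb c l2 s1 s2 s3 m1 m2 h1 h2 h3 h4 h5 h6 h7 h8 h9 h10.
have [f def_d] : {f | delta = f.+2} by exists delta.-2; lia.
have total : f.+1 * (ta + tb + c) + odd ta + odd tb + 2 <= N by rewrite def_d in h1 h2 h3 *; lia.
(* The parity term may drop by 1, but the linear term gains at least [f.+1]. This allows [ta] and
   [tb] to be replaced by their lower bound [delta - 1 - c]. *)
have mono t u : u <= t -> f.+1 * u + odd u <= f.+1 * t + odd t.
  rewrite leq_eqVlt => /orP[/eqP->//|lt_ut].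
  apply: leq_trans (leq_addr _ _); apply: leq_trans (_ : f.+1 * u.+1 <= _).
    by rewrite mulnS; have := leq_b1 (odd u); lia.
  by rewrite leq_mul2l lt_ut orbT.
have ma := mono ta (f.+1 - c); have mb := mono tb (f.+1 - c).
have {}ma : f.+1 * (f.+1 - c) + odd (f.+1 - c) <= f.+1 * ta + odd ta by apply: ma; lia.
have {}mb : f.+1 * (f.+1 - c) + odd (f.+1 - c) <= f.+1 * tb + odd tb by apply: mb; lia.
have f_gt0 : 0 < f by have := delta_ge3; rewrite def_d.
rewrite def_d; move: h10 ma mb total {mono h1 h2 h3 h4 h5 h6 h7 h8 h9}.
(* The case [c = 1], an edge in a triangle, gives exactly the claimed value; for [c = 0] the
   estimate is at least as large because [delta >= 3]. *)
case: c => [|[|//]] _; rewrite ?subn0 ?subn1 /= ?negbK; move: (odd ta) (odd tb) (odd f) => o1 o2 [] /=; lia.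
Qed.

End Edge.

(** * The ball of radius 3 around a vertex *)

Section Vertex.

Variable v : T.

Let N1 := [set x | e v x].
Let N2 := [set y | [&& y != v, y \notin N1 & [exists x in N1, e x y]]].
Let N3 := [set z | [&& z != v, z \notin N1, z \notin N2 & [exists y in N2, e y z]]].

Let N2_parent x x' y : x \in N1 -> x' \in N1 -> y \in N2 -> e x y -> e x' y -> x = x'.
Proof.
rewrite !inE => vx vx' /and3P[nyv _ _] xy x'y.
by apply: (@common_nbr v y); rewrite // 1?eq_sym // e_sym.
Qed.

(** A neighbour [z] of [y] in [N2] has the same parent [x] as [y], otherwise [v], the two parents,
    [y] and [z] form a 5-cycle. Two such neighbours would form a 4-cycle with [x] and [y]. *)
Let N2_nbrs y : y \in N2 -> #|nbrs y N2| <= 1.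
Proof.
move=> N2y; have := N2y; rewrite inE => /and3P[yv _ /exists_inP[x]]; rewrite inE => vx xy.
have sibling z : z \in nbrs y N2 -> e x z.
  rewrite in_nbrs inE => /andP[/and3P[zv N1z /exists_inP[w]] +]; rewrite inE => vw wz yz.
  have := @C5_chord v x y z w vx xy yz; rewrite e_sym wz e_sym vw => /(_ isT isT).
  rewrite (eq_sym v y) (eq_sym v z) (negbTE yv) (negbTE zv) /=.
  case/or3P=> /eqP; [move=> xz | by move=> -> | move=> yw].
    by rewrite inE -xz vx in N1z.
  by move: N2y; rewrite yw !inE vw andbF.
apply/card_le1_eqP => z z' yz yz'.
have [xz xz'] := (sibling z yz, sibling z' yz').
move: yz yz'; rewrite !in_nbrs => /andP[_ yz] /andP[_ yz'].
exact: common_nbr (edge_neq xy) xz' yz' xz yz.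
Qed.

Let N2_card : degree e v * (delta - 2) <= #|N2|.
Proof.
apply: leq_trans (_ : \sum_(x in N1) #|nbrs x N2| <= _); last first.
  by apply: sum_card_rel_leq => x x' y; apply: N2_parent.
rewrite -sum_nat_const; apply: leq_sum => x; rewrite inE => vx.
rewrite leq_subLR; apply: leq_trans (deg_ge x) _.
have N1_le1 : #|nbrs x N1| <= 1.
  apply/card_le1_eqP => y z; rewrite !in_nbrs !inE => /andP[vy xy] /andP[vz xz].
  exact: common_nbr (edge_neq vx) vz xz vy xy.
apply: leq_trans (_ : #|[set v] :|: nbrs x N1 :|: nbrs x N2| <= _).
  apply/subset_leq_card/subsetP => y; rewrite inE !in_setU !in_nbrs in_set1 => xy.
  rewrite xy !andbT; have [//|yv] := eqVneq y v; have [//|N1y] := boolP (y \in N1).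
  by rewrite inE yv N1y; apply/exists_inP; exists x; rewrite ?inE.
apply: leq_trans (leq_card_setU _ _) _; rewrite leq_add2r.
by apply: leq_trans (leq_card_setU _ _) _; rewrite cards1 leq_add2l.
Qed.

Let N3_nbrs y : y \in N2 -> delta - 2 <= #|nbrs y N3|.
Proof.
move=> N2y; have := N2y; rewrite inE => /and3P[yv N1y _].
rewrite leq_subLR; apply: leq_trans (deg_ge y) _.
have N1_le1 : #|nbrs y N1| <= 1.
  apply/card_le1_eqP => x x'; rewrite !in_nbrs => /andP[N1x yx] /andP[N1x' yx'].
  by apply: N2_parent N1x' N1x N2y _ _; rewrite e_sym.
apply: leq_trans (_ : #|nbrs y N1 :|: nbrs y N2 :|: nbrs y N3| <= _).
  apply/subset_leq_card/subsetP => z; rewrite inE !in_setU !in_nbrs => yz.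
  rewrite yz !andbT; have [//|N1z] := boolP (z \in N1); have [//|N2z] := boolP (z \in N2).
  rewrite inE N1z N2z /= andbC; apply/andP; split; first by apply/exists_inP; exists y.
  by apply: contraNneq N1y => zv; rewrite inE -zv e_sym.
apply: leq_trans (leq_card_setU _ _) _; rewrite leq_add2r.
apply: leq_trans (leq_card_setU _ _) _; exact: leq_add N1_le1 (N2_nbrs N2y).
Qed.

(* Two vertices of the third layer have at most one common neighbour. *)
Let N3_pairs : #|N2| * 'C(delta - 2, 2) <= 'C(#|N3|, 2).
Proof.
rewrite -cards_draws -sum_nat_const.
apply: leq_trans (_ : \sum_(y in N2)
  #|[set A in [set A : {set T} | A \subset N3 & #|A| == 2] | A \subset nbrs y N3]| <= _).
  apply: leq_sum => y N2y; apply: leq_trans (leq_bin2l 2 (N3_nbrs N2y)) _.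
  rewrite -cards_draws; apply/subset_leq_card/subsetP => A; rewrite !inE => /andP[sA ->].
  rewrite sA !andbT; apply: subset_trans sA _.
  by apply/subsetP => z; rewrite in_nbrs => /andP[].
apply: sum_card_rel_leq => y y' A _ _; rewrite inE => /andP[_ /cards2P[z [z' [nzz' ->]]]] yA y'A.
have nbr w u : u \in [set z; z'] -> [set z; z'] \subset nbrs w N3 -> e u w.
  by move=> Au /subsetP/(_ u Au); rewrite in_nbrs e_sym => /andP[].
by apply: (common_nbr nzz'); apply: nbr; rewrite // !inE eqxx ?orbT.
Qed.

(** The witness [m] is the size of the third layer. The quadratic condition is [N3_pairs] doubled,
    which turns binomials into falling factorials. *)
Lemma vertex_neighbourhood_card (B : {set T}) : v \in B ->
  (forall x, e v x -> x \in B) ->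
  (forall x y, e v x -> e x y -> y \in B) ->
  (forall x y z, e v x -> e x y -> e y z -> z \in B) ->
  exists m, [/\ 0 < m, 1 + degree e v * (delta - 1) + m <= #|B|
    & degree e v * (delta - 2) * ((delta - 2) * (delta - 3)) <= m * (m - 1)].
Proof.
move=> B0 B1 B2 B3; exists #|N3|; split.
- have N2_gt0 : 0 < #|N2|.
    apply: leq_trans N2_card; rewrite muln_gt0.
    have := deg_ge v; have := delta_ge3; lia.
  have [y N2y] := card_gt0P N2_gt0.
  apply: leq_trans (_ : #|nbrs y N3| <= _).
    by apply: leq_trans (N3_nbrs N2y); have := delta_ge3; lia.
  by apply/subset_leq_card/subsetP => z; rewrite in_nbrs => /andP[].
- apply: leq_trans (_ : 1 + #|N1| + #|N2| + #|N3| <= _).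
    by have := N2_card; have := delta_ge3; rewrite /degree -/N1; nia.
  apply: leq_trans (_ : #|[set v] :|: N1 :|: N2 :|: N3| <= _).
    rewrite !cardsU cards1 (_ : [set v] :&: N1 = set0).
      rewrite (_ : _ :&: N2 = set0).
        rewrite (_ : _ :&: N3 = set0) ?cards0 ?subn0 //.
        apply/setP => z; rewrite in_set0; apply/negP.
        rewrite in_setI !in_setU in_set1 [z \in N3]inE.
        by case/andP=> /orP[/orP[]|] z0 /and4P[z1 z2 z3 _]; rewrite z0 in z1 z2 z3.
      apply/setP => z; rewrite in_set0; apply/negP.
      rewrite in_setI !in_setU in_set1 [z \in N2]inE.
      by case/andP=> /orP[] z0 /and3P[z1 z2 _]; rewrite z0 in z1 z2.
    by apply/setP => z; rewrite !inE; case: eqP => //= ->; rewrite e_irr.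
  apply/subset_leq_card/subsetP => w; rewrite !in_setU in_set1 => /orP[/orP[/orP[/eqP->|]|]|] //.
  - by rewrite inE; apply: B1.
  - by rewrite inE => /and3P[_ _ /exists_inP[x]]; rewrite inE; apply: B2.
  - rewrite inE => /and4P[_ _ _ /exists_inP[y]]; rewrite inE.
    by case/and3P=> _ _ /exists_inP[x]; rewrite inE; apply: B3.
- have := leq_trans (leq_mul N2_card (leqnn _)) N3_pairs.
  rewrite -(leq_pmul2r (isT : 0 < 2`!)) -mulnA !bin_ffact !ffactnS !ffactn0 !muln1.
  by rewrite !subn1 (_ : (delta - 2).-1 = delta - 3) //; have := delta_ge3; lia.
Qed.

End Vertex.

End LocalCounting.

(** * The bound *)

Section BallSizes.

Variables (T : finType) (e : rel T) (v : T) (delta : nat).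
Hypotheses (e_sym : symmetric e) (e_irr : irreflexive e).
Hypothesis e_conn : connected_graph e.
Hypothesis delta_ge3 : 3 <= delta.
Hypothesis deg_ge : forall x, delta <= degree e x.
Hypotheses (noC4 : ~~ has_cycle_of_length e 4)
           (noC5 : ~~ has_cycle_of_length e 5).

Lemma dist_le2 x y z : e x y -> e y z -> dist e x z <= 2.
Proof.
by move=> exy eyz; apply: (@dist_path _ e x [:: y; z]); rewrite /= exy eyz.
Qed.

Lemma centre_ball_card p : centre e v p ->
  2 * delta * delta + 5 + 2 * odd delta <= #|centre_ball e v p| + 5 * delta.
Proof.
have edge_ball a b (B : {set T}) : e a b ->
    (forall w, minn (dist e a w) (dist e b w) <= 2 -> w \in B) ->
    2 * delta * delta + 5 + 2 * odd delta <= #|B| + 5 * delta.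
  move=> eab near_B.
  apply: (edge_neighbourhood_card e_sym e_irr delta_ge3 deg_ge noC4 noC5 eab).
    by move=> w /orP[] /dist_edge le1; apply: near_B; lia.
  by move=> x w /orP[] ex exw; apply: near_B; have := dist_le2 ex exw; lia.
case: p => a b; rewrite /centre /=; have [[-> ->] _|nv /= eab] := eqVneq (a, b) (v, v).
  (* The ball of radius 3 around [v] contains the ball of radius 2 around any edge at [v]. *)
  have [x vx] : exists x, e v x.
    have /card_gt0P[x] : 0 < degree e v by apply: leq_trans (deg_ge v); lia.
    by rewrite inE; exists x.
  apply: (edge_ball v x) => // w; rewrite inE /centre_dist eqxx => le2.
  by have := dist_triangle e_conn x v w; have := dist_edge vx; lia.
by apply: (edge_ball a b) => // w; rewrite inE /centre_dist (negbTE nv).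
Qed.

Lemma heavy_ball_card :
  exists m, [/\ 0 < m, 1 + degree e v * (delta - 1) + m <= #|centre_ball e v (v, v)|
    & degree e v * (delta - 2) * ((delta - 2) * (delta - 3)) <= m * (m - 1)].
Proof.
have near_B w : dist e v w <= 3 -> w \in centre_ball e v (v, v).
  by rewrite inE /centre_dist eqxx; lia.
apply: (vertex_neighbourhood_card e_sym e_irr delta_ge3 deg_ge noC4 noC5).
- by rewrite near_B // distxx.
- by move=> x /dist_edge le1; rewrite near_B //; lia.
- by move=> x y vx /(dist_le2 vx) le2; rewrite near_B //; lia.
- move=> x y z vx xy yz; rewrite near_B //.
  by apply: (@dist_path _ e v [:: x; y; z]); rewrite /= vx xy yz.
Qed.

End BallSizes.

(** With [x = D - r] and [y = k - D], the radius bound reads [k - 2 * y - 2 <= 2 * x]. Squaring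
    gives the claim when the left side is positive; otherwise [k <= 2 * y + 2] suffices. *)
Lemma square_deficit_bound k D r : D <= k -> 2 * r <= k + 2 ->
  k ^ 2 <= 4 * (D - r) ^ 2 + 4 * k * (k - D) + 4 * k.
Proof.
move=> le_Dk le_rk; rewrite -!mulnn.
have [y def_k] : {y | k = D + y} by exists (k - D); lia.
have [x def_x] : {x | x = D - r} by exists (D - r).
rewrite -def_x {1 2 3 5}def_k def_k addKn.
have [le_ky|lt_yk] := leqP k (2 * y + 2); first by nia.
have le_x : k <= 2 * x + 2 * y + 2 by lia.
nia.
Qed.

Local Open Scope ring_scope.

Lemma delta_circE (R : rcfType) (delta s : nat) :
  (s + 5 * delta = 2 * delta * delta + 5 + 2 * odd delta)%N ->
  delta_circ R delta = s%:R.
Proof.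
move=> /(congr1 (fun n => n%:R : R)); rewrite !natrD !natrM /delta_circ expr2.
by case: (odd delta) => /=; lra.
Qed.

(** The square of the root term [q] is at most [m * (m - 1)], hence at most [(m - 1/2) ^ 2]. So [m]
    is at least [q + 1/2], and the vertex itself completes the 3/2. *)
Lemma Delta_circ_leq (R : rcfType) (delta Delta m b : nat) :
  (3 <= delta)%N -> (0 < m)%N -> (1 + Delta * (delta - 1) + m <= b)%N ->
  (Delta * (delta - 2) * ((delta - 2) * (delta - 3)) <= m * (m - 1))%N ->
  Delta_circ R delta Delta <= b%:R.
Proof.
move=> delta_ge3 m_gt0; rewrite -(ler_nat R) !natrD natrM natrB; last by lia.
move=> le_b; rewrite -(ler_nat R) !natrM !natrB //; last by lia.
move=> le_m; rewrite /Delta_circ.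
have d3 : 3 <= delta%:R :> R by rewrite (ler_nat R 3).
have D0 : 0 <= Delta%:R :> R by rewrite ler0n.
have m1 : 1 <= m%:R :> R by rewrite (ler_nat R 1).
set q := _ * Num.sqrt _.
have q_sqr : q ^+ 2 = (delta%:R - 2) ^+ 2 * (Delta%:R * (delta%:R - 3)).
  by rewrite exprMn sqr_sqrtr // mulr_ge0 // subr_ge0.
have q_ge0 : 0 <= q by rewrite mulr_ge0 ?sqrtr_ge0 // subr_ge0; lra.
have q_le : q <= m%:R - 1 / 2.
  rewrite -(@ler_pXn2r _ 2) // ?nnegrE //; last by lra.
  by rewrite q_sqr !expr2; nra.
lra.
Qed.

Lemma avec_arith (R : rcfType) (n A s k D x t : R) :
  0 < n -> 0 < s -> 0 <= A -> 0 <= k -> D <= k -> s * k + A <= n ->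
  k ^+ 2 <= 4 * x ^+ 2 + 4 * k * (k - D) + 4 * k ->
  t + 6 * (s * x ^+ 2) <= (6 * D + 13) * n ->
  n^-1 * t <= (n - A) / (2 * s) * ((9 * n + 3 * A) / n) + 21.
Proof.
move=> n_gt0 s_gt0 A_ge0 k_ge0 le_Dk le_n le_k le_t.
pose K := (n - A) / s.
have sK : s * K = n - A by rewrite /K mulrC divfK // gt_eqF.
have -> : (n - A) / (2 * s) * ((9 * n + 3 * A) / n) + 21
    = n^-1 * (K / 2 * (9 * n + 3 * A) + 21 * n).
  by rewrite /K; field; rewrite !gt_eqF.
rewrite ler_pM2l ?invr_gt0 //.
have le_kK : k <= K by rewrite -(ler_pM2l s_gt0) sK; lra.
have sy : s * k * (k - D) <= n * (k - D) by apply: ler_wpM2r; lra.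
have sk : s * k ^+ 2 <= s * (4 * x ^+ 2 + 4 * k * (k - D) + 4 * k).
  by rewrite ler_pM2l.
(* [le_k] eliminates [x], and [s * k <= n] absorbs both the terms in [k - D] and the linear term
   [6 * s * k]; thus 19 = 13 + 6. *)
have t_le : t <= 6 * n * k - 3 / 2 * s * k ^+ 2 + 19 * n.
  by rewrite !expr2 in sk le_t *; nra.
(* The bound on [t] is increasing in [k] up to [K], as [s * k] and [s * K] are at most [n]. At
   [k = K] its main part is [K / 2 * (9 * n + 3 * A)]. *)
have mono : 0 <= (K - k) * (6 * n - 3 / 2 * (s * K + s * k)).
  by apply: mulr_ge0; lra.
have A_def : A = n - s * K by rewrite sK; lra.
rewrite A_def; rewrite !expr2 in t_le; nra.
Qed.

Theorem theorem8 (R : rcfType) (T : finType) (e : rel T) (n delta Delta : nat)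
    (e_sym : symmetric e) (e_irr : irreflexive e)
    (e_conn : connected_graph e)
    (n_order : #|T| = n)
    (delta_min : min_degree e = delta) (delta_ge3 : (3 <= delta)%N)
    (Delta_max : max_degree e = Delta)
    (noC4 : ~~ has_cycle_of_length e 4)
    (noC5 : ~~ has_cycle_of_length e 5) :
  avec e R <=
    (n%:R - Delta_circ R delta Delta) / (2 * delta_circ R delta)
      * ((9 * n%:R + 3 * Delta_circ R delta Delta) / n%:R) + 21.
Proof.
have deg_ge x : (delta <= degree e x)%N by rewrite -delta_min; apply: bigminn_leq.
have n_gt0 : (0 < n)%N.
  (* On an empty vertex set [min_degree] takes its default value [#|T|], which is 0, against
     [delta >= 3]. *)
  rewrite -n_order lt0n; apply: contraTneq delta_ge3 => T0.
  by rewrite -delta_min /min_degree big_pred0 ?T0 // => x; have := card0_eq T0 x.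
have [v deg_v] : {v | max_degree e = degree e v}.
  by apply: bigop.eq_bigmax; rewrite n_order.
have [S S_pack S_dom] := packing_exists v e_sym e_irr e_conn.
(* The natural number whose image in [R] is [delta_circ]. *)
pose s := (2 * delta * delta + 5 + 2 * odd delta - 5 * delta)%N.
have s_def : (s + 5 * delta = 2 * delta * delta + 5 + 2 * odd delta)%N.
  by rewrite /s subnK //; nia.
have s_gt0 : (0 < s)%N by rewrite /s subn_gt0; nia.
have s_ball p : p \in S -> (s <= #|centre_ball e v p|)%N.
  move=> Sp; rewrite -(leq_add2r (5 * delta)) s_def.
  exact: centre_ball_card (packing_centre S_pack Sp).
have [m [m_gt0 m_ball m_pairs]] :=
  heavy_ball_card v e_sym e_irr delta_ge3 deg_ge noC4 noC5.
have [k [D [r [le_n le_Dk le_rk le_t]]]] :=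
  sum_ecc_contraction e_sym e_conn S_pack S_dom s_ball (leqnn _).
rewrite n_order in le_n le_t; rewrite -deg_v Delta_max in m_ball m_pairs.
have le_k := square_deficit_bound le_Dk le_rk.
rewrite (delta_circE R s_def) /avec n_order -natr_sum.
apply: (@avec_arith R _ _ _ k%:R D%:R (D - r)%:R); rewrite ?ltr0n ?ler0n ?ler_nat //.
- rewrite /Delta_circ !addr_ge0 ?mulr_ge0 ?sqrtr_ge0 ?ler0n ?invr_ge0 ?ler0n //.
    by rewrite subr_ge0 (ler_nat R 1); lia.
  by rewrite subr_ge0 (ler_nat R 2); lia.
- apply: le_trans (_ : (s * k + #|centre_ball e v (v, v)|)%:R <= _).
    by rewrite natrD natrM lerD2l; apply: Delta_circ_leq m_ball m_pairs.
  by rewrite ler_nat.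
- by rewrite -natrB // -!natrX -!natrM -!natrD ler_nat.
- by rewrite -!natrX -!natrM -!natrD -!natrM ler_nat.
Qed.
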